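(* Let $z=(z_{i,j})\in\mathbb{R}^{n\times m}$, $z_{i,j}=y_i\phi(\theta_j,x_i)$, be the signed fixed features, with rows $z_i\in\mathbb{R}^m$ and $\|z\|_\infty=\max_{i,j}|z_{i,j}|>0$, and let $$F_m(r)=-\log\Big(\frac1n\sum_{i=1}^n\exp\Big(-\frac1m\sum_{j=1}^m z_{i,j}r_j^2\Big)\Big),\qquad r\in\mathbb{R}_+^m.$$ Consider the gradient ascent iterates $r(t+1)=r(t)+\eta(t)\,m\nabla F_m(r(t))$, $t\in\mathbb{N}$, with step-sizes $\eta(t)=1/(16\|z\|_\infty\sqrt{t+1})$ and a uniform initialization $r(0)\propto\mathbf{1}$ (i.e. $r(0)=c\mathbf 1$ with $c>0$). Let $a_j(t)=r_j(t)^2/m$ for $j\in[m]$, $\beta(t)=\|a(t)\|_1$ and $\bar a(t)=a(t)/\beta(t)$. Then for all $t\ge1$, $$\max_{0\le s\le t-1}\min_{i\in[n]}z_i^\top\bar a(s)\ \ge\ \gamma_1^{(m)}-\frac{\|z\|_\infty}{\sqrt t}\big(8\log(m)+\log(t)+1\big)-\frac{4B\log n}{\sqrt t},$$ where $\gamma_1^{(m)}:=\max_{a\in\Delta^{m-1}}\min_{i\in[n]}z_i^\top a$ and $B:=\sum_{s=0}^\infty\frac{1}{\beta(s)\sqrt{s+1}}$, and $B<\infty$ when $\gamma_1^{(m)}>0$.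
   Context: $(x_i,y_i)_{i\in[n]}$ is a training set with $x_i\in\mathbb{R}^d$, $y_i\in\{-1,1\}$; $\phi:\mathbb{R}^p\times\mathbb{R}^d\to\mathbb{R}$ is a feature function, positively 2-homogeneous in its first variable and balanced (there is $T:\mathbb{S}^{p-1}\to\mathbb{S}^{p-1}$ with $\phi(T(\theta),\cdot)=-\phi(\theta,\cdot)$ for all $\theta$); $\theta_1,\dots,\theta_m\in\mathbb{S}^{p-1}$ are fixed. $\Delta^{m-1}=\{a\in\mathbb{R}_+^m:\mathbf{1}^\top a=1\}$ is the simplex and $[n]=\{1,\dots,n\}$. *)

(* Defs.v *)
From HB Require Import structures.
From mathcomp Require Import all_boot all_order all_algebra.
From mathcomp Require Import all_classical all_reals all_analysis.

Set Implicit Arguments.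
Unset Strict Implicit.
Unset Printing Implicit Defensive.

Import Order.TTheory GRing.Theory Num.Theory.
Import numFieldNormedType.Exports.

Local Open Scope classical_set_scope.
Local Open Scope ring_scope.

(* R^k is 'rV[R]_k, whose library norm `|u| is the sup-norm; the Euclidean and
   l1 norms are therefore introduced here. *)
Definition norm2 (R : realType) (k : nat) (u : 'rV[R]_k) : R :=
  Num.sqrt (\sum_(j < k) u 0 j ^+ 2).

Definition norm1 (R : realType) (k : nat) (u : 'rV[R]_k) : R :=
  \sum_(j < k) `|u 0 j|.

Definition sphere2 (R : realType) (k : nat) : set 'rV[R]_k :=
  [set u | norm2 u = 1].

Definition simplex (R : realType) (m : nat) : set 'rV[R]_m :=
  [set a | (forall j, 0 <= a 0 j) /\ \sum_(j < m) a 0 j = 1].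

Definition pos_homogeneous2 (R : realType) (p d : nat)
    (phi : 'rV[R]_p -> 'rV[R]_d -> R) : Prop :=
  forall (l : R) (u : 'rV[R]_p) (x : 'rV[R]_d),
    0 < l -> phi (l *: u) x = l ^+ 2 * phi u x.

(* T : S^{p-1} -> S^{p-1} is represented by a map of the ambient space that
   preserves the sphere. *)
Definition balanced (R : realType) (p d : nat)
    (phi : 'rV[R]_p -> 'rV[R]_d -> R) : Prop :=
  exists T : 'rV[R]_p -> 'rV[R]_p, forall u : 'rV[R]_p, sphere2 u ->
    sphere2 (T u) /\ (forall x : 'rV[R]_d, phi (T u) x = - phi u x).

(* There are n.+1 >= 1 data points, so seeding with index ord0 makes this the
   minimum of z_i^T a over the rows i. *)
Definition min_margin (R : realType) (n m : nat)
    (z : 'M[R]_(n.+1, m)) (a : 'rV[R]_m) : R :=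
  \big[Num.min/(\sum_(j < m) z ord0 j * a 0 j)]_(i < n.+1)
    \sum_(j < m) z i j * a 0 j.

Definition max_margin (R : realType) (n m : nat) (z : 'M[R]_(n.+1, m)) : R :=
  sup [set min_margin z a | a in @simplex R m].

(* The same formula defines F_m on the whole of R^m, not only on R_+^m. *)
Definition objective (R : realType) (n m : nat)
    (z : 'M[R]_(n.+1, m)) (r : 'rV[R]_m) : R :=
  - ln (n.+1%:R^-1 *
        \sum_(i < n.+1) expR (- (m%:R^-1 * \sum_(j < m) z i j * r 0 j ^+ 2))).

Definition gradient (R : realType) (m : nat)
    (f : 'rV[R]_m -> R) (r : 'rV[R]_m) : 'rV[R]_m :=
  \row_(j < m) 'D_(delta_mx 0 j) f r.

(* `|z| is the library norm on matrices, the maximum of the `|z i j|. *)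
Definition stepsize (R : realType) (n m : nat)
    (z : 'M[R]_(n.+1, m)) (t : nat) : R :=
  1 / (16 * `|z| * Num.sqrt t.+1%:R).

Definition weights (R : realType) (m : nat) (r : 'rV[R]_m) : 'rV[R]_m :=
  \row_(j < m) (r 0 j ^+ 2 / m%:R).

Definition mass (R : realType) (m : nat) (r : 'rV[R]_m) : R :=
  norm1 (weights r).

Definition normalized_weights (R : realType) (m : nat)
    (r : 'rV[R]_m) : 'rV[R]_m :=
  (mass r)^-1 *: weights r.

(* An extended real: the series has nonnegative terms, and equals +oo when it
   diverges. *)
Definition mass_series (R : realType) (m : nat)
    (r : nat -> 'rV[R]_m) : \bar R :=
  (\sum_(0 <= s <oo) (1 / (mass (r s) * Num.sqrt s.+1%:R))%:E)%E.

(* Main.v *)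
Require Import Defs.
From HB Require Import structures.
From mathcomp Require Import all_boot all_order all_algebra.
From mathcomp Require Import all_classical all_reals all_analysis.
From mathcomp Require Import ring lra.
(* Let [g] be the convex combination of the rows [z_i] with softmin weights at
   [a t], i.e. the gradient in [a] of the objective. The iteration reads
   [r_j (t+1) = r_j t * (1 + u_j t)] with [u = 2 eta g], so [a] follows
   multiplicative weights with factor [(1 + u_j) ^ 2], where
   [|u_j t| <= e t := 1 / (8 sqrt (t+1))]. Comparing [ln (beta t)] with a convex
   combination [w] of the [ln (a_j t)] gives the regret bound
   [2 sum_s <w - abar s, u s> <= ln m + 5 sum_s (e s) ^ 2].
   For [w] in the simplex, [<w, g>] is at least the margin of [w], since [g]
   averages the rows, while [<abar, g>] is at most the margin of [abar] plus
   [ln n / beta], since the entropy of the softmin weights is at most [ln n].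
   Weighting by the step sizes and dividing by their sum gives the rate. The same
   comparison with a maximizer [w] bounds [ln (beta t)] below by a multiple of
   [sqrt t] up to [ln t], whence the convergence of the series. *)

Import Order.TTheory GRing.Theory Num.Theory.
Import numFieldNormedType.Exports.
Local Open Scope classical_set_scope.
Local Open Scope ring_scope.

(** * Elementary bounds on logarithms and sums *)

(** From [ln (1 + v) <= v] at [v = - u / (1 + u)] comes [u / (1 + u) <= ln (1 + u)], and the left
    side exceeds [u - 2 u^2] by [u^2 (1 + 2 u) / (1 + u)]. *)
Lemma ln1D_ge {R : realType} {u : R} : `|u| <= 1 / 2 ->
  u - 2 * u ^+ 2 <= ln (1 + u).
Proof.
rewrite ler_norml => /andP[u_ge u_le].
have u1_gt0 : 0 < 1 + u by lra.
have ineq : ln (1 + - (u / (1 + u))) <= - (u / (1 + u)).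
  by apply: le_ln1Dx; rewrite ltrN2 ltr_pdivrMr //; lra.
have inv1u : 1 + - (u / (1 + u)) = (1 + u)^-1.
  by field; rewrite gt_eqF.
move: ineq; rewrite inv1u lnV ?posrE // lerN2; apply: le_trans.
rewrite ler_pdivlMr //; nra.
Qed.

(** The increment [1 / (t + 2)] is at most [ln ((t + 2) / (t + 1))], again by [ln (1 + v) <= v]. *)
Lemma sum_inv_le_ln (R : realType) (t : nat) : (1 <= t)%N ->
  \sum_(0 <= s < t) (s.+1%:R : R)^-1 <= 1 + ln t%:R.
Proof.
case: t => // t _; elim: t => [|t IHt]; first by rewrite big_nat1 ln1 invr1 addr0.
rewrite big_nat_recr //=.
have t1_gt0 : 0 < t.+1%:R :> R by rewrite ltr0n.
have t2_gt0 : 0 < t.+2%:R :> R by rewrite ltr0n.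
have ineq : ln (1 + - (t.+2%:R : R)^-1) <= - (t.+2%:R)^-1.
  by apply: le_ln1Dx; rewrite ltrN2 invf_lt1 // ltr1n.
have quot : 1 + - (t.+2%:R : R)^-1 = t.+1%:R / t.+2%:R.
  rewrite -[X in X + _](divff (lt0r_neq0 t2_gt0)) -mulN1r -mulrDl.
  by rewrite -natr1 addrK.
move: ineq IHt; rewrite quot ln_div ?posrE //.
by move: (t.+2%:R^-1) (\sum_(_ <= _ < _) _) => x y; lra.
Qed.

(** Each of the [t] terms is at least [1 / sqrt t]. *)
Lemma sum_inv_sqrt_ge (R : realType) (t : nat) :
  Num.sqrt (t%:R : R) <= \sum_(0 <= s < t) (Num.sqrt (s.+1%:R : R))^-1.
Proof.
case: t => [|t]; first by rewrite big_geq // sqrtr0.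
have sq_gt0 : 0 < Num.sqrt (t.+1%:R : R) by rewrite sqrtr_gt0 ltr0n.
have -> : Num.sqrt (t.+1%:R : R)
    = \sum_(0 <= s < t.+1) (Num.sqrt (t.+1%:R : R))^-1.
  rewrite big_const_nat subn0 iter_addr addr0 -[RHS]mulr_natl.
  by rewrite -[X in X / _](@sqr_sqrtr R) ?ler0n // expr2 mulfK // gt_eqF.
apply: ler_sum_nat => s /andP[_ st].
by rewrite lef_pV2 ?posrE ?sqrtr_gt0 ?ltr0n // ler_wsqrtr // ler_nat.
Qed.

(** * Multiplicative weights and their regret *)

Section MultiplicativeWeights.
Context {R : realType} {m : nat}.
Context {a u : nat -> 'I_m -> R} {e : nat -> R} {a0 : R}.
Hypotheses (m_gt0 : (0 < m)%N) (a0_gt0 : 0 < a0).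
Hypothesis a_init : forall j, a 0%N j = a0.
Hypothesis a_step : forall t j, a t.+1 j = a t j * (1 + u t j) ^+ 2.
Hypothesis u_le : forall t j, `|u t j| <= e t.
Hypothesis e_le : forall t, e t <= 1 / 2.

Local Notation total t := (\sum_(j < m) a t j).

Let u1_gt0 t j : 0 < 1 + u t j.
Proof. by move: (le_trans (u_le t j) (e_le t)); rewrite ler_norml; lra. Qed.

Let sqr_u_le t j : u t j ^+ 2 <= e t ^+ 2.
Proof.
by rewrite -[leLHS]real_normK ?num_real // lerXn2r ?nnegrE // (le_trans _ (u_le t j)).
Qed.

Lemma mw_gt0 t j : 0 < a t j.
Proof.
by elim: t => [|t IHt]; rewrite ?a_init // a_step mulr_gt0 // exprn_gt0.
Qed.

Lemma mw_total_gt0 t : 0 < total t.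
Proof.
rewrite (bigD1 (Ordinal m_gt0)) //= ltr_pwDl ?mw_gt0 //.
by apply: sumr_ge0 => j _; exact/ltW/mw_gt0.
Qed.

Lemma mw_lower t j :
  ln a0 + \sum_(0 <= s < t) (2 * u s j - 4 * e s ^+ 2) <= ln (a t j).
Proof.
elim: t => [|t IHt]; first by rewrite big_geq // addr0 a_init.
rewrite big_nat_recr //= addrA a_step lnM ?posrE ?mw_gt0 ?exprn_gt0 //.
rewrite lerD // lnXn // -mulr_natl.
have := ln1D_ge (le_trans (u_le t j) (e_le t)).
by have := sqr_u_le t j; lra.
Qed.

(** Expanding [(1 + u)^2 = 1 + 2 u + u^2] bounds the ratio of successive totals by [1 + c]; then
    [ln (1 + c) <= c]. *)
Lemma mw_upper t :
  ln (total t) <= ln (m%:R * a0)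
    + \sum_(0 <= s < t) (2 * (\sum_j a s j / total s * u s j) + e s ^+ 2).
Proof.
elim: t => [|t IHt].
  rewrite big_geq // addr0 (eq_bigr (fun=> a0)) => [|j _]; last exact: a_init.
  by rewrite sumr_const card_ord -[_ *+ m]mulr_natl.
rewrite big_nat_recr //= addrA.
have tot_gt0 := mw_total_gt0 t.
have tot_neq0 := lt0r_neq0 tot_gt0.
set c := 2 * _ + _ in IHt *.
suff growth : total t.+1 <= total t * (1 + c).
  (* [c] may be negative; [1 + c > 0] follows from the positivity of the next total. *)
  have c1_gt0 : 0 < 1 + c.
    by rewrite -(pmulr_rgt0 _ tot_gt0) (lt_le_trans (mw_total_gt0 _) growth).
  apply: (le_trans (_ : _ <= ln (total t * (1 + c)))).
    by rewrite ler_ln ?posrE ?mw_total_gt0 // mulr_gt0.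
  rewrite lnM ?posrE //; apply: lerD => //.
  by apply: le_ln1Dx; lra.
rewrite /c mulrDr mulr1 mulrDr mulrCA !mulr_sumr.
rewrite mulr_suml -!big_split /=.
apply: ler_sum => j _; rewrite a_step.
have -> : total t * (a t j / total t * u t j) = a t j * u t j by field.
by have := sqr_u_le t j; have := mw_gt0 t j; nra.
Qed.

Context {w : 'I_m -> R}.
Hypotheses (w_ge0 : forall j, 0 <= w j) (w_sum : \sum_j w j = 1).

(** [ln (total t)] is the [w]-average of itself and dominates every [ln (a t j)], so [mw_lower] can
    be averaged with weights [w]. *)
Lemma mw_growth t :
  ln a0 + \sum_(0 <= s < t) (2 * (\sum_j w j * u s j) - 4 * e s ^+ 2)
    <= ln (total t).
Proof.
have -> : ln (total t) = \sum_j w j * ln (total t).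
  by rewrite -mulr_suml w_sum mul1r.
apply: (@le_trans _ _ (\sum_j w j *
    (ln a0 + \sum_(0 <= s < t) (2 * u s j - 4 * e s ^+ 2)))).
  under [leRHS]eq_bigr do rewrite mulrDr mulr_sumr.
  rewrite [leRHS]big_split /= -mulr_suml w_sum mul1r exchange_big /=.
  rewrite lerD // ler_sum // => s _.
  under [leRHS]eq_bigr do rewrite mulrBr mulrCA.
  by rewrite sumrB -mulr_suml w_sum mul1r mulr_sumr.
apply: ler_sum => j _; apply: ler_wpM2l => //.
apply: (le_trans (mw_lower t j)).
rewrite ler_ln ?posrE ?mw_gt0 ?mw_total_gt0 //.
rewrite (bigD1 j) //= lerDl sumr_ge0 // => k _; exact/ltW/mw_gt0.
Qed.

(** [ln a0] cancels between the two bounds, and 5 = 4 + 1 collects their quadratic losses. *)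
Lemma mw_regret t :
  2 * \sum_(0 <= s < t)
      (\sum_j w j * u s j - \sum_j a s j / total s * u s j)
    <= ln m%:R + 5 * \sum_(0 <= s < t) e s ^+ 2.
Proof.
have := le_trans (mw_growth t) (mw_upper t).
rewrite lnM ?posrE ?ltr0n // !sumrB !big_split /= -!mulr_sumr; lra.
Qed.

End MultiplicativeWeights.

(** * Softmin weights and the gradient of the objective *)

Section Gradient.
Context {R : realType} {n m : nat}.
Implicit Types (z : 'M[R]_(n.+1, m)) (r a w : 'rV[R]_m).

Definition row_margin z a (i : 'I_n.+1) : R := \sum_(j < m) z i j * a 0 j.

Definition softmin_sum z a : R := \sum_i expR (- row_margin z a i).

Definition softmin z a (i : 'I_n.+1) : R :=
  expR (- row_margin z a i) / softmin_sum z a.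

Lemma softmin_sum_gt0 z a : 0 < softmin_sum z a.
Proof.
rewrite /softmin_sum big_ord_recl ltr_pwDl ?expR_gt0 //.
by apply: sumr_ge0 => i _; exact: expR_ge0.
Qed.

Lemma softmin_ge0 z a i : 0 <= softmin z a i.
Proof. by rewrite divr_ge0 ?expR_ge0 // ltW ?softmin_sum_gt0. Qed.

Lemma sum_softmin z a : \sum_i softmin z a i = 1.
Proof. by rewrite -mulr_suml divff // gt_eqF ?softmin_sum_gt0. Qed.

(** Coordinate [j] of the gradient of [- ln (softmin_sum z a)] in [a]. *)
Definition softmin_col z a (j : 'I_m) : R := \sum_i softmin z a i * z i j.

Lemma derive_lineE (f : 'rV[R]_m -> R) r v :
  'D_v f r = 'D_1 (fun h : R => f (h *: v + r)) 0.
Proof.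
rewrite /derive scale0r add0r.
by under [in RHS]eq_fun => h do rewrite /= addr0 [h%:A]mulr1.
Qed.

Lemma is_derive_fsum (k : nat) (f : 'I_k -> R -> R) (x : R) (df : 'I_k -> R) :
  (forall i, is_derive x 1 (f i) (df i)) ->
  is_derive x 1 (fun h => \sum_i f i h) (\sum_i df i).
Proof.
by move=> /is_derive_sum; congr is_derive; apply/funext => h; rewrite fct_sumE.
Qed.

(** The square in [weights] produces the factor [r 0 j], which makes the ascent step
    multiplicative. *)
Lemma gradient_objective z r j :
  m%:R * gradient (objective z) r 0 j = 2 * r 0 j * softmin_col z (weights r) j.
Proof.
have m_neq0 : m%:R != 0 :> R by rewrite pnatr_eq0; case: (m) j => [[]|].
(* Along the line through [r] in direction [j], [q k] is coordinate [k], [V i] the margin of row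
   [i], and [S] the softmin sum. *)
pose q k (h : R) := (h *: delta_mx 0 j + r) 0 k.
have dq k : is_derive (0 : R) 1 (q k) (k == j)%:R.
  have -> : q k = (k == j)%:R \*: id + cst (r 0 k).
    by apply/funext => h; rewrite /q !mxE eqxx /= mulrC.
  by apply: is_derive_eq; rewrite addr0 [_ *: 1]mulr1.
pose V i h := m%:R^-1 * \sum_k z i k * q k h ^+ 2.
pose dV i := m%:R^-1 * (2 * z i j * r 0 j).
have q0 k : q k 0 = r 0 k by rewrite /q scale0r add0r.
have V0 i : V i 0 = row_margin z (weights r) i.
  rewrite /V mulr_sumr; apply: eq_bigr => k _.
  by rewrite q0 mxE mulrCA [_ * m%:R^-1]mulrC.
have is_dV i : is_derive (0 : R) 1 (V i) (dV i).
  have -> : dV i = m%:R^-1 *: \sum_k z i k *: ((2 * q k 0) *: (k == j)%:R).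
    rewrite (bigD1 j) //= big1 => [|k /negPf ->]; last first.
      by rewrite !scaler0.
    by rewrite addr0 q0 eqxx /dV /GRing.scale /=; ring.
  apply: is_deriveZ; apply: is_derive_fsum => k.
  exact: is_deriveZ (is_deriveX 2 (dq k)).
pose S h := \sum_i expR (- V i h).
have is_dS : is_derive (0 : R) 1 S (\sum_i expR (- V i 0) * - dV i).
  by apply: is_derive_fsum => i; exact: is_derive1_comp.
have S0 : S 0 = softmin_sum z (weights r).
  by apply: eq_bigr => i _; rewrite V0.
have S_gt0 : 0 < n.+1%:R^-1 * S 0.
  by rewrite S0 mulr_gt0 ?invr_gt0 ?ltr0n ?softmin_sum_gt0.
have is_dF : is_derive (0 : R) 1 (fun h => - ln (n.+1%:R^-1 * S h))
    (- ((n.+1%:R^-1 * S 0)^-1 * (n.+1%:R^-1 * \sum_i expR (- V i 0) * - dV i))).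
  have is_dln := @is_derive1_comp R (@ln R) (n.+1%:R^-1 \*: S) 0 _ _
    (is_derive1_ln S_gt0) (is_deriveZ n.+1%:R^-1 is_dS).
  exact: is_deriveN is_dln.
rewrite mxE derive_lineE.
rewrite [X in _ * X](@derive_val _ _ _ _ _ _ _ is_dF).
have S_neq0 := lt0r_neq0 (softmin_sum_gt0 z (weights r)).
have -> : \sum_i expR (- V i 0) * - dV i
    = - (2 * r 0 j / m%:R
         * (softmin_sum z (weights r) * softmin_col z (weights r) j)).
  rewrite /softmin_col !mulr_sumr -sumrN; apply: eq_bigr => i _.
  by rewrite V0 /dV /softmin; field; rewrite S_neq0 m_neq0.
have N_neq0 : n.+1%:R != 0 :> R by rewrite pnatr_eq0.
rewrite S0; move: (n.+1%:R) N_neq0 => N N_neq0.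
by field; rewrite m_neq0 S_neq0 N_neq0.
Qed.

(** * Margins against softmin averages *)

Lemma min_margin_le z a i : min_margin z a <= row_margin z a i.
Proof. exact: bigmin_le. Qed.

Lemma min_margin_attained z a : exists i, min_margin z a = row_margin z a i.
Proof.
rewrite /min_margin; elim/big_ind: _ => [|x y [i ->] [k ->]|i _].
- by exists ord0.
- by case: leP => _; [exists i|exists k].
- by exists i.
Qed.

Lemma row_marginZ z c a i : row_margin z (c *: a) i = c * row_margin z a i.
Proof. by rewrite mulr_sumr; apply: eq_bigr => j _; rewrite mxE mulrCA. Qed.

Lemma sum_softmin_col z a w :
  \sum_j w 0 j * softmin_col z a j = \sum_i softmin z a i * row_margin z w i.
Proof.
under eq_bigr do rewrite mulr_sumr.
rewrite exchange_big /=; apply: eq_bigr => i _; rewrite mulr_sumr.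
by apply: eq_bigr => j _; ring.
Qed.

Lemma min_margin_le_softmin z a w :
  min_margin z w <= \sum_j w 0 j * softmin_col z a j.
Proof.
rewrite sum_softmin_col -[leLHS]mul1r -(sum_softmin z a) mulr_suml.
by apply: ler_sum => i _; rewrite ler_wpM2l ?softmin_ge0 ?min_margin_le.
Qed.

(* Gibbs: with [v_i] the margins and [S] the sum of the [exp (- v_i)], applying
   [1 + x <= exp x] to [x = v_i + ln S - ln n] and averaging bounds the entropy
   of the softmin by [ln n]. *)
Lemma softmin_le z a i :
  \sum_j a 0 j * softmin_col z a j <= row_margin z a i + ln n.+1%:R.
Proof.
rewrite sum_softmin_col.
have S_gt0 := softmin_sum_gt0 z a.
set S := softmin_sum z a in S_gt0 *.
have N_gt0 : 0 < n.+1%:R :> R by rewrite ltr0n.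
have lnS_ge : - row_margin z a i <= ln S.
  rewrite -[leLHS]expRK ler_ln ?posrE ?expR_gt0 //.
  rewrite /S /softmin_sum (bigD1 i) //= lerDl.
  by apply: sumr_ge0 => k _; exact: expR_ge0.
have : \sum_k softmin z a k * (1 + (row_margin z a k + ln S - ln n.+1%:R)) <= 1.
  apply: (@le_trans _ _ (\sum_(k < n.+1) n.+1%:R^-1)); last first.
    by rewrite sumr_const card_ord -[_ *+ _]mulr_natl divff ?gt_eqF.
  apply: ler_sum => k _.
  apply: (le_trans (ler_wpM2l (softmin_ge0 _ _ _) (expR_ge1Dx _))).
  rewrite !expRD expRN !lnK ?posrE // /softmin -/S expRN.
  have E_neq0 : expR (row_margin z a k) != 0 by rewrite gt_eqF ?expR_gt0.
  move: (expR _) E_neq0 => E E_neq0.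
  move: (n.+1%:R) N_gt0 => N N_gt0.
  rewrite [leLHS](_ : _ = N^-1) //; field.
  by rewrite E_neq0 !gt_eqF.
have -> : \sum_k softmin z a k * (1 + (row_margin z a k + ln S - ln n.+1%:R))
    = \sum_k softmin z a k * row_margin z a k + (1 + ln S - ln n.+1%:R).
  rewrite -[X in _ + X]mul1r -(sum_softmin z a) mulr_suml -big_split /=.
  by apply: eq_bigr => k _; rewrite sum_softmin; ring.
lra.
Qed.

(** An average of entries of one column; hence the step size alone controls the multiplicative
    factors. *)
Lemma softmin_col_le z a j : `|softmin_col z a j| <= `|z|.
Proof.
apply: (le_trans (ler_norm_sum _ _ _)).
rewrite -[leRHS]mul1r -(sum_softmin z a) mulr_suml; apply: ler_sum => i _.
rewrite normrM ger0_norm ?softmin_ge0 // ler_wpM2l ?softmin_ge0 //.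
rewrite [leRHS]/Num.norm /= mx_normrE.
exact: (le_bigmax _ (fun ij => `|z ij.1 ij.2|) (i, j)).
Qed.

(** * Existence of a maximal margin *)

Lemma continuous_row_margin z i : continuous (fun a => row_margin z a i).
Proof.
move=> a; apply: (cvg_big add_continuous (nbhs_filter a)) => j _.
by apply: cvgM; [exact: cvg_cst|exact: coord_continuous].
Qed.

Lemma continuous_min_margin z : continuous (min_margin z).
Proof.
(* The induction runs over the list of rows, with the seed row [ord0] held fixed. *)
suff min_cont s :
    continuous (fun a => \big[Num.min/row_margin z a ord0]_(i <- s) row_margin z a i).
  exact: min_cont.
elim: s => [|i s IHs] a.
  under eq_fun do rewrite big_nil.
  exact: continuous_row_margin.
under eq_fun do rewrite big_cons.
exact: (continuous_min (continuous_row_margin z i a) (IHs a)).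
Qed.

(** A closed subset of the cube [[0, 1]^m]. *)
Lemma compact_simplex : compact (@simplex R m).
Proof.
have cube := @rV_compact R m (fun=> `[0, 1]%classic) (fun=> @segment_compact R 0 1).
apply: (subclosed_compact _ cube) => [|a [a_ge0 a_sum] j /=].
  have -> : @simplex R m = \bigcap_(j in [set: 'I_m])
      ((fun a : 'rV[R]_m => a 0 j) @^-1` [set x | 0 <= x])
      `&` ((fun a : 'rV[R]_m => \sum_j a 0 j) @^-1` [set x | x = 1]).
    by apply/seteqP; split => a /= [a_ge0 a_sum]; split => // j *; exact: a_ge0.
  apply: closedI.
    apply: closed_bigI => j _; apply: preimage_closed; last exact: closed_ge.
    by move=> a _; exact: coord_continuous.
  apply: preimage_closed; last exact: closed_eq.
  move=> a _; apply: (cvg_big add_continuous (nbhs_filter a)) => j _.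
  exact: coord_continuous.
rewrite in_itv /= a_ge0 /= -a_sum (bigD1 j) //= lerDl.
by apply: sumr_ge0.
Qed.

Lemma simplex_neq0 : (0 < m)%N -> @simplex R m !=set0.
Proof.
move=> m_gt0; exists (const_mx m%:R^-1); split => [j|].
  by rewrite mxE invr_ge0.
rewrite (eq_bigr (fun=> m%:R^-1)) => [|j _]; last by rewrite mxE.
by rewrite sumr_const card_ord -[_ *+ m]mulr_natl divff // pnatr_eq0 -lt0n.
Qed.

Lemma max_margin_attained z : (0 < m)%N ->
  exists2 a : 'rV[R]_m, simplex a & min_margin z a = max_margin z.
Proof.
move=> /simplex_neq0 m_gt0.
have [c /set_mem cS c_max] := EVT_max_rV m_gt0 compact_simplex
  (continuous_subspaceT (continuous_min_margin z)).
have c_ub : ubound [set min_margin z a | a in @simplex R m] (min_margin z c).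
  by move=> _ [a aS <-]; apply: c_max; rewrite inE.
exists c => //; apply/eqP; rewrite eq_le; apply/andP; split.
  by apply: ub_le_sup; [exists (min_margin z c)|exists c].
by apply: ge_sup => //; exists (min_margin z c); exists c.
Qed.

End Gradient.

(** * Gradient ascent as multiplicative weights *)

Section Dynamics.
Context {R : realType} {n m : nat}.
Context {z : 'M[R]_(n.+1, m)} {r : nat -> 'rV[R]_m} {c : R}.
Hypotheses (m_gt0 : (0 < m)%N) (z_gt0 : 0 < `|z|) (c_gt0 : 0 < c).
Hypothesis r_init : r 0%N = const_mx c.
Hypothesis r_step : forall t,
  r t.+1 = r t + (stepsize z t * m%:R) *: gradient (objective z) (r t).

Let a t j := weights (r t) 0 j.
Let u t j := 2 * stepsize z t * softmin_col z (weights (r t)) j.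
Let sg (t : nat) : R := (Num.sqrt t.+1%:R)^-1.
Let e t := sg t / 8.

Let sg_gt0 t : 0 < sg t.
Proof. by rewrite invr_gt0 sqrtr_gt0. Qed.

Let sg_le1 t : sg t <= 1.
Proof. by rewrite invf_le1 ?sqrtr_gt0 // -[leLHS]sqrtr1 ler_wsqrtr // ler1n. Qed.

Let sqr_e t : e t ^+ 2 = t.+1%:R^-1 / 64.
Proof.
rewrite /e /sg expr_div_n exprVn sqr_sqrtr //.
by congr (_ / _); rewrite -natrX.
Qed.

Let stepsizeE t : 2 * stepsize z t * `|z| = e t.
Proof.
rewrite /stepsize /e /sg.
move: (Num.sqrt _) (sqrtr_gt0 (t.+1%:R : R)) => q.
rewrite ltr0n => q_gt0.
by field; rewrite !gt_eqF.
Qed.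

Let step_gt0 t : 0 < stepsize z t.
Proof.
by rewrite -(pmulr_lgt0 _ z_gt0) -(pmulr_rgt0 _ (ltr0n R 2)) mulrA stepsizeE divr_gt0.
Qed.

Let a0 : R := c ^+ 2 / m%:R.

Let a0_gt0 : 0 < a0.
Proof. by rewrite divr_gt0 ?exprn_gt0 ?ltr0n. Qed.

Let a_init j : a 0%N j = a0.
Proof. by rewrite /a mxE r_init mxE. Qed.

Let a_step t j : a t.+1 j = a t j * (1 + u t j) ^+ 2.
Proof.
rewrite /a mxE r_step mxE [X in _ + X]mxE -mulrA gradient_objective.
by rewrite /u [weights (r t) 0 j]mxE; ring.
Qed.

Let u_le t j : `|u t j| <= e t.
Proof.
have eta_ge0 : 0 <= 2 * stepsize z t by rewrite mulr_ge0 // ltW.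
by rewrite normrM ger0_norm // -stepsizeE ler_wpM2l ?softmin_col_le.
Qed.

Let e_le t : e t <= 1 / 2.
Proof. by have := sg_le1 t; rewrite /e; lra. Qed.

Lemma massE t : mass (r t) = \sum_j weights (r t) 0 j.
Proof.
apply: eq_bigr => j _; rewrite ger0_norm // mxE.
by rewrite divr_ge0 ?sqr_ge0.
Qed.

Lemma mass_gt0 t : 0 < mass (r t).
Proof.
by rewrite massE; exact: (mw_total_gt0 m_gt0 a0_gt0 a_init a_step u_le e_le t).
Qed.

Let w_u (w : 'rV[R]_m) t : 2 * stepsize z t * min_margin z w <= \sum_j w 0 j * u t j.
Proof.
under eq_bigr do rewrite mulrCA.
rewrite -mulr_sumr ler_wpM2l ?min_margin_le_softmin //.
by rewrite mulr_ge0 // ltW.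
Qed.

(** As [e t] is [2 * stepsize z t] times the norm of [z], the right side is [e t] times
    [<w, g> - (<a, g> - ln n) / mass]. Here [<w, g>] is at least the margin of [w], and [softmin_le]
    at a row of least margin bounds the subtracted term. *)
Let margin_gap (w : 'rV[R]_m) t :
  e t * (min_margin z w - min_margin z (normalized_weights (r t)))
    <= `|z| * (\sum_j w 0 j * u t j
               - \sum_j a t j / (\sum_k a t k) * u t j)
       + e t * (ln n.+1%:R / mass (r t)).
Proof.
have [i ->] := min_margin_attained z (normalized_weights (r t)).
rewrite row_marginZ -massE.
have M_gt0 := mass_gt0 t.
pose G := \sum_j w 0 j * softmin_col z (weights (r t)) j.
pose A := \sum_j a t j * softmin_col z (weights (r t)) j.
have -> : \sum_j w 0 j * u t j = 2 * stepsize z t * G.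
  by rewrite mulr_sumr; apply: eq_bigr => j _; rewrite mulrCA.
have -> : \sum_j a t j / mass (r t) * u t j = 2 * stepsize z t * (A / mass (r t)).
  by rewrite mulr_suml mulr_sumr; apply: eq_bigr => j _; rewrite /u; ring.
have -> : `|z| * (2 * stepsize z t * G - 2 * stepsize z t * (A / mass (r t)))
    + e t * (ln n.+1%:R / mass (r t))
    = e t * (G - (mass (r t))^-1 * (A - ln n.+1%:R)).
  by rewrite -stepsizeE; ring.
have e_ge0 : 0 <= e t by rewrite divr_ge0 // ltW.
rewrite ler_wpM2l // lerB //; first exact: min_margin_le_softmin.
by rewrite ler_wpM2l ?invr_ge0 ?(ltW M_gt0) // lerBlDr softmin_le.
Qed.

(** The partial sum keeps the bound real-valued; passing to the full, possibly infinite, series only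
    weakens it. *)
Lemma margin_bound t : (1 <= t)%N ->
  max_margin z - `|z| / Num.sqrt t%:R * (8 * ln m%:R + ln t%:R + 1)
    - 4 * (\sum_(0 <= s < t) 1 / (mass (r s) * Num.sqrt s.+1%:R))
        * (ln n.+1%:R / Num.sqrt t%:R)
  <= \big[Num.max/min_margin z (normalized_weights (r 0%N))]_(0 <= s < t)
       min_margin z (normalized_weights (r s)).
Proof.
move=> t_ge1; set M := leRHS.
have [w [w_ge0 w_sum] <-] := max_margin_attained z m_gt0.
set gamma := min_margin z w; set B := (X in 4 * X * _).
have M_ge s : (s < t)%N -> min_margin z (normalized_weights (r s)) <= M.
  move=> st; rewrite /M.
  apply: (le_bigmax_seq _ s xpredT (fun k => min_margin z (normalized_weights (r k)))).
    by rewrite mem_index_iota.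
  by [].
have regret := mw_regret m_gt0 a0_gt0 a_init a_step u_le e_le w_ge0 w_sum t.
(* Sum [margin_gap] and multiply by 8, as [e = sg / 8]. The squares of [e] sum to at most
   [(1 + ln t) / 64], so half the regret bound contributes [4 ln m + 20 / 64 (1 + ln t)]. *)
have sum_gap : (gamma - M) * \sum_(0 <= s < t) sg s
    <= `|z| * (4 * ln m%:R + 20 / 64 * (1 + ln t%:R)) + B * ln n.+1%:R.
  have : \sum_(0 <= s < t) e s * (gamma - M) <= \sum_(0 <= s < t)
      (`|z| * (\sum_j w 0 j * u s j - \sum_j a s j / (\sum_k a s k) * u s j)
       + e s * (ln n.+1%:R / mass (r s))).
    apply: ler_sum_nat => s /andP[_ st].
    apply: le_trans (margin_gap w s).
    have e_ge0 : 0 <= e s by rewrite divr_ge0 // ltW.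
    by rewrite ler_wpM2l // lerB // M_ge.
  have -> : \sum_(0 <= s < t) e s * (gamma - M)
      = (gamma - M) * (\sum_(0 <= s < t) sg s) / 8.
    rewrite -mulr_suml -mulr_suml; ring.
  have sqr_sum : \sum_(0 <= s < t) e s ^+ 2 <= (1 + ln t%:R) / 64.
    under eq_bigr do rewrite sqr_e.
    by rewrite -mulr_suml ler_pM2r // sum_inv_le_ln.
  have -> : \sum_(0 <= s < t)
      (`|z| * (\sum_j w 0 j * u s j - \sum_j a s j / (\sum_k a s k) * u s j)
       + e s * (ln n.+1%:R / mass (r s)))
     = `|z| * (\sum_(0 <= s < t)
         (\sum_j w 0 j * u s j - \sum_j a s j / (\sum_k a s k) * u s j))
       + B * ln n.+1%:R / 8.
    rewrite big_split /= -mulr_sumr /B !mulr_suml; congr (_ + _).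
    by apply: eq_bigr => s _; rewrite /e /sg mul1r invfM; ring.
  set D := (X in `|z| * X + _); move: regret; rewrite -/D => regret.
  have : `|z| * D <= `|z| * ((ln m%:R + 5 * ((1 + ln t%:R) / 64)) / 2).
    rewrite ler_wpM2l //; lra.
  lra.
have sqt_gt0 : 0 < Num.sqrt (t%:R : R) by rewrite sqrtr_gt0 ltr0n.
have B_ge0 : 0 <= B.
  by apply: sumr_ge0 => s _; rewrite divr_ge0 // mulr_ge0 // ltW // mass_gt0.
have lnm_ge0 : 0 <= ln (m%:R : R) by rewrite ln_ge0 // ler1n.
have lnt_ge0 : 0 <= ln (t%:R : R) by rewrite ln_ge0 // ler1n.
have lnn_ge0 : 0 <= ln (n.+1%:R : R) by rewrite ln_ge0 // ler1n.
rewrite !lerBlDr.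
have -> : M + 4 * B * (ln n.+1%:R / Num.sqrt t%:R)
      + `|z| / Num.sqrt t%:R * (8 * ln m%:R + ln t%:R + 1)
    = M + (`|z| * (8 * ln m%:R + ln t%:R + 1) + 4 * B * ln n.+1%:R)
       / Num.sqrt t%:R by ring.
rewrite -lerBlDl ler_pdivlMr //.
set rhs := leRHS.
have rhs_ge : `|z| * (4 * ln m%:R + 20 / 64 * (1 + ln t%:R)) + B * ln n.+1%:R <= rhs.
  have : `|z| * (4 * ln m%:R + 20 / 64 * (1 + ln t%:R))
      <= `|z| * (8 * ln m%:R + ln t%:R + 1).
    by rewrite ler_wpM2l //; lra.
  by have := mulr_ge0 B_ge0 lnn_ge0; rewrite /rhs; lra.
(* Replacing the sum of the [sg s] by its lower bound [sqrt t] needs a nonnegative factor; for a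
   negative one the right side, being nonnegative, suffices. *)
have [gap_ge0|gap_le0] := leP 0 (gamma - M).
  apply: le_trans rhs_ge; apply: le_trans sum_gap.
  by rewrite ler_wpM2l // sum_inv_sqrt_ge.
apply: (@le_trans _ _ 0); first by rewrite nmulr_rle0 // ltW.
apply: le_trans rhs_ge; rewrite addr_ge0 // mulr_ge0 //; lra.
Qed.

(* The comparison with a maximizer forces [mass (r t)] above
   [exp (k sqrt t) / t], hence above a multiple of [t ^ 2]. *)
Lemma mass_growth : 0 < max_margin z ->
  exists2 C : R, 0 < C & forall t, (1 <= t)%N -> C * t%:R ^+ 2 <= mass (r t).
Proof.
move=> gamma_gt0.
have [w [w_ge0 w_sum] w_max] := max_margin_attained z m_gt0.
set gamma := max_margin z in gamma_gt0 w_max.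
(* Chosen so that [k * sg s] equals [2 * (2 * stepsize z s * gamma)], the guaranteed gain in
   [ln (mass (r s))] before quadratic losses. *)
pose k := gamma / (4 * `|z|).
have k_gt0 : 0 < k by rewrite divr_gt0 // mulr_gt0.
have k6_gt0 : 0 < k ^+ 6 / 6`!%:R.
  by rewrite divr_gt0 ?exprn_gt0 // ltr0n fact_gt0.
have C_gt0 : 0 < a0 * expR (- 1) * (k ^+ 6 / 6`!%:R).
  by rewrite mulr_gt0 // mulr_gt0 // expR_gt0.
(* The degree 6 term of the exponential at [k sqrt t] is a multiple of [t^3]; the loss [1 + ln t]
   then costs [expR (- 1)] and one power of [t]. *)
exists (a0 * expR (- 1) * (k ^+ 6 / 6`!%:R)) => // t t_ge1.
have t_gt0 : 0 < t%:R :> R by rewrite ltr0n.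
have growth := mw_growth m_gt0 a0_gt0 a_init a_step u_le e_le w_ge0 w_sum t.
have exponent : k * Num.sqrt t%:R - (1 + ln t%:R) <=
    \sum_(0 <= s < t) (2 * (\sum_j w 0 j * u s j) - 4 * e s ^+ 2).
  apply: (@le_trans _ _ (\sum_(0 <= s < t) (k * sg s - s.+1%:R^-1 / 16))).
    rewrite sumrB -mulr_sumr -mulr_suml.
    have lnt_ge0 : 0 <= ln (t%:R : R) by rewrite ln_ge0 // ler1n.
    have sqrt_le : Num.sqrt t%:R <= \sum_(0 <= s < t) sg s := sum_inv_sqrt_ge R t.
    have := ler_wpM2l (ltW k_gt0) sqrt_le.
    by have := sum_inv_le_ln R t t_ge1; lra.
  apply: ler_sum => s _; rewrite sqr_e lerB //; last first.
    by move: (s.+1%:R^-1) => q; lra.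
  have := w_u w s; rewrite w_max.
  have -> : k * sg s = 2 * (2 * stepsize z s * gamma).
    have -> : sg s = 8 * e s by rewrite /e; lra.
    by rewrite -stepsizeE /k; field; rewrite gt_eqF.
  by rewrite ler_pM2l.
rewrite -ler_ln ?posrE ?mass_gt0 ?massE //; last first.
  by rewrite mulr_gt0 // exprn_gt0.
apply: le_trans growth.
apply: (@le_trans _ _ (ln a0 + (k * Num.sqrt t%:R - (1 + ln t%:R)))); last first.
  by rewrite lerD2l.
have poly_le : k ^+ 6 / 6`!%:R * t%:R ^+ 3 <= expR (k * Num.sqrt t%:R).
  have x_ge0 : 0 <= k * Num.sqrt t%:R by rewrite mulr_ge0 // ltW.
  have sqrt6 : Num.sqrt (t%:R : R) ^+ 6 = t%:R ^+ 3.
    by rewrite (exprM _ 2 3) sqr_sqrtr.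
  have := expR_ge1Dxn 5 x_ge0; rewrite exprMn sqrt6.
  move: (6`!%:R : R) (_ ^+ 3) => q q'; lra.
move: (k ^+ 6 / _) k6_gt0 poly_le => q q_gt0.
rewrite -[leLHS]lnK ?posrE ?mulr_gt0 ?exprn_gt0 // ler_expR.
rewrite lnM ?posrE ?exprn_gt0 // lnXn // => poly_le.
move: a0 a0_gt0 => b b_gt0.
rewrite lnM ?posrE ?exprn_gt0 ?mulr_gt0 ?expR_gt0 //.
rewrite lnM ?posrE ?mulr_gt0 ?expR_gt0 // lnM ?posrE ?expR_gt0 // expRK lnXn //.
lra.
Qed.

Lemma mass_series_lt_pinfty : 0 < max_margin z -> (mass_series r < +oo)%E.
Proof.
move=> /mass_growth [C C_gt0 mass_ge].
have term_ge0 s : 0 <= 1 / (mass (r s) * Num.sqrt s.+1%:R).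
  by rewrite divr_ge0 // mulr_ge0 // ltW // mass_gt0.
pose K := 1 / mass (r 0%N) + 2 / C.
have partial_le N : \sum_(0 <= s < N) 1 / (mass (r s) * Num.sqrt s.+1%:R) <= K.
  (* Two more terms put indices 0 and 1 in the base case; index 0 lies outside the range of
     [mass_growth]. *)
  apply: (@le_trans _ _ (\sum_(0 <= s < N.+2) 1 / (mass (r s) * Num.sqrt s.+1%:R))).
    by rewrite 2?big_nat_recr //= -addrA lerDl addr_ge0.
  (* The subtracted term makes the induction close, through [1 / (N + 2)^2 <= 1 / (N + 1) - 1 / (N +
     2)]. *)
  suff : \sum_(0 <= s < N.+2) 1 / (mass (r s) * Num.sqrt s.+1%:R)
      <= K - C^-1 / N.+1%:R.
    by move=> /le_trans; apply; rewrite gerBl divr_ge0 // invr_ge0 ltW.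
  have term_le s : (1 <= s)%N ->
      1 / (mass (r s) * Num.sqrt s.+1%:R) <= C^-1 / s%:R ^+ 2.
    move=> s_ge1; have s_gt0 : 0 < s%:R :> R by rewrite ltr0n.
    have sq_gt0 : 0 < Num.sqrt (s.+1%:R : R) by rewrite sqrtr_gt0.
    rewrite mul1r -invfM lef_pV2 ?posrE ?mulr_gt0 ?mass_gt0 ?exprn_gt0 //.
    apply: (le_trans (mass_ge s s_ge1)).
    by rewrite ler_peMr ?(ltW (mass_gt0 s)) // -[leLHS]sqrtr1 ler_wsqrtr // ler1n.
  elim: N => [|N IHN].
    rewrite big_nat_recr //= big_nat1 sqrtr1 mulr1 divr1 /K.
    by have := term_le 1%N isT; rewrite expr1n divr1; lra.
  rewrite big_nat_recr //=; apply: (le_trans (lerD IHN (term_le _ _))) => //.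
  rewrite -addrA lerD2l.
  have N1_gt0 : 0 < N.+1%:R :> R by rewrite ltr0n.
  rewrite -(natr1 N.+1) -mulrN -mulrDr -mulrN ler_pM2l ?invr_gt0 //.
  move: (N.+1%:R) N1_gt0 => x x_gt0.
  rewrite addrC -subr_ge0.
  have -> : - (x + 1)^-1 - ((x + 1) ^- 2 - x^-1) = (x * (x + 1) ^+ 2)^-1.
    by field; rewrite !gt_eqF // addr_gt0.
  by rewrite invr_ge0 mulr_ge0 ?sqr_ge0 // ltW.
apply: (@le_lt_trans _ _ K%:E); last exact: ltry.
apply: lime_le; first by apply: is_cvg_nneseries => s _ _; rewrite lee_fin.
by apply: nearW => N; rewrite sumEFin lee_fin.
Qed.

End Dynamics.

Theorem proposition6 (R : realType) (n m p d : nat)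
    (x : 'I_n.+1 -> 'rV[R]_d) (y : 'I_n.+1 -> R)
    (hy : forall i, y i = -1 \/ y i = 1)
    (phi : 'rV[R]_p -> 'rV[R]_d -> R)
    (phi_hom : pos_homogeneous2 phi) (phi_bal : balanced phi)
    (theta : 'I_m -> 'rV[R]_p) (htheta : forall j, sphere2 (theta j))
    (z : 'M[R]_(n.+1, m))
    (hz : forall i j, z i j = y i * phi (theta j) (x i))
    (z_gt0 : 0 < `|z|)
    (r : nat -> 'rV[R]_m)
    (r_init : exists2 c : R, 0 < c & r 0%N = const_mx c)
    (r_step : forall t : nat,
       r t.+1 = r t + (stepsize z t * m%:R) *: gradient (objective z) (r t)) :
  (* the supremum defining max_margin is a maximum *)
  (exists2 a : 'rV[R]_m, simplex a & min_margin z a = max_margin z) /\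
  (forall t : nat, (1 <= t)%N ->
     ((\big[Num.max/min_margin z (normalized_weights (r 0%N))]_(0 <= s < t)
          min_margin z (normalized_weights (r s)))%:E
      >= (max_margin z
          - `|z| / Num.sqrt t%:R * (8 * ln m%:R + ln t%:R + 1))%:E
         - 4%:E * mass_series r * (ln n.+1%:R / Num.sqrt t%:R)%:E)%E) /\
  (0 < max_margin z -> (mass_series r < +oo)%E).
Proof.
(* A matrix without columns would have norm 0. *)
have m_gt0 : (0 < m)%N.
  case: m z z_gt0 {hz r r_init r_step theta htheta} => // z.
  suff -> : z = 0 by rewrite normr0 ltxx.
  by apply/matrixP => i [].
have [c c_gt0 r0] := r_init.
split; first exact: max_margin_attained.
split=> [t t_ge1|]; last exact: (mass_series_lt_pinfty m_gt0 z_gt0 c_gt0 r0 r_step).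
have mass_pos := mass_gt0 m_gt0 z_gt0 c_gt0 r0 r_step.
have := margin_bound m_gt0 z_gt0 c_gt0 r0 r_step t t_ge1.
(* The series dominates its partial sums, and its coefficient is nonnegative, so monotonicity
   applies even at [+oo]. *)
rewrite -lee_fin; apply: le_trans.
rewrite [leRHS]EFinB leeB // EFinM EFinM -sumEFin.
apply: lee_wpmul2r.
  by rewrite lee_fin divr_ge0 // ln_ge0 // ler1n.
apply: lee_wpmul2l; first by rewrite lee_fin.
apply: nneseries_lim_ge => s _ _.
by rewrite lee_fin divr_ge0 // mulr_ge0 // ltW.
Qed.
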